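(* Let $n\ge1$, $\alpha>1$, and let $(p_A)_{A\subset[n]}$ be a probability distribution on subsets of $[n]$ with $p_\varnothing=0$. Suppose there exist $(p_m)_{m=1}^n$ such that $p_A=p_m$ whenever $|A|=m$, and suppose $p_n<1$. Then, for the WARM with $W(x)=x^\alpha$ and subset law $(p_A)$, the equilibrium $\vec 1/n=(1/n,\dots,1/n)$ is linearly stable if and only if $$\alpha<\frac{1}{n^2\sum_{m=2}^n\frac{p_m}{m^2}\binom{n-2}{m-2}},$$ where the right-hand side is read as $+\infty$ if the sum is $0$. Moreover, $\vec 1/n$ is critical if and only if equality holds in this inequality.
   Context: $[n]=\{1,\dots,n\}$ and $\Delta_n=\{\vec u\in\mathbb R^n:u_i\ge0,\ \sum_i u_i=1\}$. A WARM is the urn model in which at each time a random subset $A$ of the $n$ colours is chosen (i.i.d., with probability $p_A$), and then a colour $i\in A$ is selected with probability proportional to $W$(current number of balls of colour $i$) and a ball of that colour is added. For $\vec v\in\Delta_n$, $F(\vec v)_i=-v_i+\sum_{A\ni i}p_A\,\frac{v_i^\alpha}{\sum_{j\in A}v_j^\alpha}$ (with $0/0$ read as $0$). An equilibrium is a $\vec v\in\Delta_n$ with $F(\vec v)=\vec 0$. At an equilibrium $\vec v$, $\mathbf D(\vec v)$ is the $n\times n$ matrix with entries $D_{i,k}=\partial F(\vec v)_i/\partial v_k$, namely $D_{i,i}=-1+\alpha v_i^{\alpha-1}\sum_{A\ni i}p_A\frac{\sum_{j\in A}v_j^\alpha-v_i^\alpha}{(\sum_{j\in A}v_j^\alpha)^2}$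 and, for $k\ne i$, $D_{i,k}=-\alpha v_k^{\alpha-1}v_i^\alpha\sum_{A\ni i,k}\frac{p_A}{(\sum_{j\in A}v_j^\alpha)^2}$. The equilibrium is linearly stable if all eigenvalues of $\mathbf D(\vec v)$ have negative real parts, linearly unstable if some eigenvalue has positive real part, and critical otherwise. *)

(* Defs.v *)
From mathcomp Require Import all_boot all_order all_algebra.
From mathcomp Require Import all_classical all_reals all_analysis.
From mathcomp.real_closed Require Import complex.
From mathcomp Require Import ring.

Set Implicit Arguments.
Unset Strict Implicit.
Unset Printing Implicit Defensive.

Import Order.TTheory GRing.Theory Num.Theory numFieldNormedType.Exports.

Local Open Scope ring_scope.

(* Colours are 'I_n. *)
Definition is_subset_law (R : realType) (n : nat) (p : {set 'I_n} -> R) : Prop :=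
  (forall A, 0 <= p A) /\ \sum_(A : {set 'I_n}) p A = 1 /\ p (finset.set0 : {set _}) = 0.

Section WARM.
Context {R : realType} {n : nat}.
Variables (p : {set 'I_n} -> R) (alpha : R).
Implicit Types v : 'rV[R]_n.

Definition in_simplex v : Prop :=
  (forall i, 0 <= v 0 i) /\ \sum_(i < n) v 0 i = 1.

Definition wsum v (A : {set 'I_n}) : R := \sum_(j in A) v 0 j `^ alpha.

(* Division by zero is zero here, so 0 / 0 reads as 0. *)
Definition warm_field v : 'rV[R]_n :=
  \row_(i < n) (- v 0 i
    + \sum_(A : {set 'I_n} | i \in A) p A * (v 0 i `^ alpha / wsum v A)).

Definition is_equilibrium v : Prop := in_simplex v /\ warm_field v = 0.

(* The matrix of partial derivatives of warm_field, in closed form; see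
   is_derive_warm_field. The closed form also covers points of the boundary of
   the simplex, where the two-sided partial derivatives involve x `^ alpha at
   x < 0. *)
Definition warm_jacobian v : 'M[R]_n :=
  \matrix_(i < n, k < n)
    if k == i then
      - 1 + alpha * v 0 i `^ (alpha - 1) *
        \sum_(A : {set 'I_n} | i \in A)
          p A * ((wsum v A - v 0 i `^ alpha) / wsum v A ^+ 2)
    else
      - (alpha * v 0 k `^ (alpha - 1) * v 0 i `^ alpha *
         \sum_(A : {set 'I_n} | (i \in A) && (k \in A))
           p A / wsum v A ^+ 2).

Definition jacobian_eigenvalue v (z : R[i]) : Prop :=
  eigenvalue (map_mx (real_complex R) (warm_jacobian v)) z.

Definition linearly_stable v : Prop :=
  forall z, jacobian_eigenvalue v z -> Re z < 0.

Definition linearly_unstable v : Prop :=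
  exists2 z, jacobian_eigenvalue v z & 0 < Re z.

Definition critical v : Prop := ~ linearly_stable v /\ ~ linearly_unstable v.

Lemma is_derive_bigsum (I : finType) (P : pred I) (f : I -> R -> R) (df : I -> R)
    (x : R) : (forall i, P i -> is_derive x 1 (f i) (df i)) ->
  is_derive x 1 (fun t => \sum_(i | P i) f i t) (\sum_(i | P i) df i).
Proof.
move=> fdf; have -> : (fun t => \sum_(i | P i) f i t) = \sum_(i | P i) f i.
  by apply/funext => t; rewrite fct_sumE.
apply: (big_ind2 (fun g dg => is_derive x (1 : R) g dg)) => //.
- exact: is_derive_cst.
- by move=> g1 d1 g2 d2 h1 h2; exact: is_deriveD.
Qed.

Lemma is_derive_warm_field v (i k : 'I_n) : (forall j, 0 < v 0 j) ->
  is_derive (0 : R) 1 (fun h : R => warm_field (v + h *: delta_mx 0 k) 0 i)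
    (warm_jacobian v i k).
Proof.
move=> v_gt0; set c := alpha * v 0 k `^ (alpha - 1).
pose x h : 'rV[R]_n := v + h *: delta_mx 0 k.
have x0 : x 0 = v by rewrite /x scale0r addr0.
have dx j : is_derive (0 : R) 1 (fun h => x h 0 j) (j == k)%:R.
  have -> : (fun h => x h 0 j) = cst (v 0 j) + (j == k)%:R *: (id : R -> R).
    by apply/funext => h; rewrite !mxE eqxx mulrC.
  by apply: is_derive_eq; rewrite add0r /GRing.scale /= mulr1.
have dpow j : is_derive (0 : R) 1 (fun h => x h 0 j `^ alpha)
    (if j == k then c else 0).
  have xj_gt0 : 0 < x 0 0 j by rewrite x0.
  have d := is_derive1_comp (is_derive1_powR alpha xj_gt0) (dx j).
  apply: is_derive_eq d _; rewrite x0.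
  by case: eqP => [->|_]; rewrite ?mulr1 ?mulr0.
have dwsum (A : {set 'I_n}) : is_derive (0 : R) 1 (fun h => wsum (x h) A)
    (if k \in A then c else 0).
  apply: (is_derive_eq (is_derive_bigsum (fun j (_ : j \in A) => dpow j))).
  rewrite -big_mkcondr; case: ifPn => kA.
    rewrite (big_pred1 k)// => j /=.
    by case: eqP => [->|_]; rewrite ?kA ?andbF.
  by rewrite big1// => j /andP[jA /eqP jk]; rewrite -jk jA in kA.
have wsum_neq0 (A : {set 'I_n}) : i \in A -> wsum (x 0) A != 0.
  move=> iA; rewrite x0 /wsum (bigD1 i)//= gt_eqF//.
  by rewrite ltr_wpDr ?powR_gt0// sumr_ge0// => j _; exact: powR_ge0.
have dquot (A : {set 'I_n}) : i \in A ->
    is_derive (0 : R) 1 (fun h => p A * (x h 0 i `^ alpha / wsum (x h) A))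
      (p A * ((if i == k then c else 0) / wsum v A
              - v 0 i `^ alpha * (if k \in A then c else 0) / wsum v A ^+ 2)).
  move=> iA; have d1 := is_deriveV (wsum_neq0 A iA) (dwsum A).
  have d2 := is_deriveZ (p A) (is_deriveM (dpow i) d1).
  apply: is_derive_eq d2 _; rewrite x0.
  have quotE (a b s s2 e g : R) :
    a * (e * (- s2 * g) + s * b) = a * (b * s - e * g * s2).
    by ring.
  exact: quotE.
have d := is_deriveD (is_deriveN (dx i))
  (is_derive_bigsum (fun (A : {set 'I_n}) (iA : i \in A) => dquot A iA)).
have -> : (fun h : R => warm_field (v + h *: delta_mx 0 k) 0 i) =
    - (fun h => x h 0 i) + (fun h => \sum_(A : {set 'I_n} | i \in A)
      p A * (x h 0 i `^ alpha / wsum (x h) A)).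
  by apply/funext => h; rewrite [LHS]mxE.
apply: is_derive_eq d _; rewrite mxE eq_sym; case: (eqVneq k i) => [ki|ki].
  congr (_ + _); rewrite /c ki mulr_sumr; apply: eq_bigr => A iA.
  have := wsum_neq0 A iA; rewrite x0 iA => w0; by field.
rewrite oppr0 add0r big_mkcondr /= mulr_sumr -sumrN; apply: eq_bigr => A iA.
case: ifP => kA; rewrite -/c; ring.
Qed.
End WARM.

Definition symmetric_sum (R : realType) (n : nat) (q : nat -> R) : R :=
  \sum_(2 <= m < n.+1) q m / m%:R ^+ 2 * 'C(n - 2, m - 2)%:R.

Definition critical_exponent (R : realType) (n : nat) (q : nat -> R) : \bar R :=
  if symmetric_sum n q == 0 then +oo%E
  else (1 / (n%:R ^+ 2 * symmetric_sum n q))%:E.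

(* Main.v *)
(** Write [T i k] for the sum of [p A / #|A|^2] over the sets [A] containing
    [i] and [k]. Grouping the sets by cardinality shows that for [i != k] it is
    the common value [T = symmetric_sum n q], and double counting turns
    the diagonal entries of the Jacobian at [1/n] into [alpha n (n - 1) T - 1].
    This Jacobian is therefore
    [(alpha n^2 T - 1) I - alpha n T J], with [J] the all-ones matrix. Its
    eigenvalues are [-1] on constant vectors and [alpha n^2 T - 1] on vectors of
    sum zero. *)

Require Import Defs.
From mathcomp Require Import all_boot all_order all_algebra.
From mathcomp Require Import all_classical all_reals all_analysis.
From mathcomp.real_closed Require Import complex.
From mathcomp Require Import ring.

Set Implicit Arguments.
Unset Strict Implicit.
Unset Printing Implicit Defensive.

Import Order.TTheory GRing.Theory Num.Theory.

Local Open Scope ring_scope.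

(** * Counting the supersets of a fixed set by cardinality *)

(** Removing [S] maps these supersets bijectively onto the subsets of the complement of [S] with
    [m - #|S|] elements; adding [S] back is the inverse. *)
Lemma card_supersets (T : finType) (S : {set T}) (m : nat) : (#|S| <= m)%N ->
  #|[set A : {set T} | S \subset A & #|A| == m]%SET| =
    'C(#|T| - #|S|, m - #|S|).
Proof.
move=> leSm; have -> : (#|T| - #|S|)%N = #|finset.setC S|.
  by rewrite [RHS]cardsCs finset.setCK.
rewrite -cards_draws -(card_in_imset (f := fun A => finset.setD A S)).
  congr #|pred_of_set _|; apply/setP => B; rewrite inE.
  apply/imsetP/andP => [[A]|[BS /eqP cB]].
    rewrite inE => /andP[SA /eqP <-] ->.
    by rewrite finset.setDE finset.subsetIr -finset.setDE finset.cardsDS.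
  have dBS : [disjoint B & S] by rewrite finset.disjoints_subset.
  exists (finset.setU S B).
    rewrite inE finset.subsetUl finset.cardsU finset.setIC.
    move: dBS; rewrite -finset.setI_eq0 => /eqP ->.
    by rewrite finset.cards0 subn0 cB subnKC ?eqxx.
  by rewrite finset.setDUl finset.setDv finset.set0U; apply/esym/finset.setDidPl.
move=> A B; rewrite !inE => /andP[SA _] /andP[SB _] eqAB.
by rewrite -(finset.setID A S) -(finset.setID B S) eqAB !(finset.setIidPr _).
Qed.

Lemma sum_supersets (V : nmodType) (T : finType) (S : {set T}) (f : nat -> V) :
  \sum_(A : {set T} | S \subset A) f #|A| =
  \sum_(#|S| <= m < #|T|.+1) f m *+ 'C(#|T| - #|S|, m - #|S|).
Proof.
have cardT (A : {set T}) : (#|A| < #|T|.+1)%N by rewrite ltnS max_card.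
rewrite (partition_big (fun A : {set T} => Ordinal (cardT A)) xpredT) //=.
rewrite -(big_mkord xpredT (fun m =>
  \sum_(A : {set T} | (S \subset A) && (#|A| == m)) f #|A|)).
(* No superset of [S] has fewer than [#|S|] elements. These terms are split off because truncated
   subtraction would give them the binomial coefficient 1. *)
rewrite (big_cat_nat (n := #|S|)) //=; last by rewrite ltnW.
rewrite big_nat big1 ?add0r => [|m /andP[_ ltmS]]; last first.
  rewrite big1 // => A /andP[/subset_leq_card leSA /eqP cA].
  by move: leSA; rewrite cA leqNgt ltmS.
apply: eq_big_nat => m /andP[leSm _].
rewrite -card_supersets // -sumr_const.
apply: eq_big => [A|A /andP[_ /eqP -> //]].
by rewrite inE.
Qed.

(** * Equilibrium and Jacobian at the uniform point *)

Section UniformEquilibrium.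
Variables (R : realType) (n : nat) (alpha : R) (p : {set 'I_n} -> R) (q : nat -> R).
Hypothesis (n_gt0 : (0 < n)%N).
Hypothesis (p_law : is_subset_law p).
Hypothesis (pq : forall (A : {set 'I_n}) (m : nat),
  (1 <= m <= n)%N -> #|A| = m -> p A = q m).

Let u : 'rV[R]_n := const_mx n%:R^-1.
Let w : R := n%:R^-1 `^ alpha.
Let T : R := symmetric_sum n q.

Lemma law_card (A : {set 'I_n}) (i : 'I_n) : i \in A -> p A = q #|A|.
Proof.
move=> iA; apply: pq => //; rewrite card_gt0.
rewrite -[X in (_ <= X)%N]card_ord max_card andbT.
by apply/set0Pn; exists i.
Qed.

(** By [sum_supersets] the sum is the same for every colour, and the [n] sums add up to the total
    mass 1, since each [A] is met [#|A|] times. This is the equilibrium equation at [1/n]. *)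
Lemma sum_law_inv_card (i : 'I_n) :
  \sum_(A : {set 'I_n} | i \in A) p A / #|A|%:R = n%:R^-1.
Proof.
pose s (j : 'I_n) := \sum_(A : {set 'I_n} | j \in A) p A / #|A|%:R.
have s_const j : s j = s i.
  have sE k : s k = \sum_(1 <= m < n.+1) q m / m%:R *+ 'C(n - 1, m - 1).
    have := sum_supersets (finset.set1 k) (fun m => q m / m%:R).
    rewrite cards1 card_ord => <-; apply: eq_big => [A|A kA].
      by rewrite finset.sub1set.
    by rewrite (law_card kA).
  by rewrite !sE.
have : \sum_j s j = 1.
  have [_ [<- p0]] := p_law.
  rewrite (exchange_big_dep xpredT) //=; apply: eq_bigr => A _.
  rewrite sumr_const -mulrnAl -[_ *+ _]mulr_natr.
  (* [#|A|] cannot be cancelled at the empty set, where [p] vanishes instead. *)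
  have [->|A0] := eqVneq A finset.set0; first by rewrite p0 !mul0r.
  by rewrite mulfK // pnatr_eq0 cards_eq0.
rewrite (eq_bigr _ (fun j _ => s_const j)) sumr_const card_ord => sn1.
have n0 : n%:R != 0 :> R by rewrite pnatr_eq0 -lt0n.
by apply: (mulIf n0); rewrite mulVf // mulr_natr.
Qed.

Lemma sum_law_pair (i k : 'I_n) : k != i ->
  \sum_(A : {set 'I_n} | (i \in A) && (k \in A)) p A / #|A|%:R ^+ 2 = T.
Proof.
move=> ki; rewrite /T /symmetric_sum.
have := sum_supersets (finset.setU (finset.set1 i) (finset.set1 k))
  (fun m => q m / m%:R ^+ 2).
rewrite cards2 eq_sym ki card_ord => sE.
under [RHS]eq_bigr do rewrite mulr_natr.
rewrite -sE; apply: eq_big => [A|A /andP[iA _]].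
  by rewrite finset.subUset !finset.sub1set.
by rewrite (law_card iA).
Qed.

(** The factor [#|A| - 1] counts the [k != i] in [A]; exchanging the sums leaves [n - 1] pair sums,
    each equal to [T]. *)
Lemma sum_law_diag (i : 'I_n) :
  \sum_(A : {set 'I_n} | i \in A) p A * (#|A|%:R - 1) / #|A|%:R ^+ 2 =
  n.-1%:R * T.
Proof.
transitivity (\sum_(k | k != i)
    \sum_(A : {set 'I_n} | (i \in A) && (k \in A)) p A / #|A|%:R ^+ 2).
  rewrite (exchange_big_dep (fun A : {set 'I_n} => i \in A)) /=; last first.
    by move=> k A _ /andP[].
  apply: eq_bigr => A iA.
  rewrite (eq_bigl (fun k => k \in (A :\ i)%SET)); last first.
    by move=> k; rewrite !inE iA.
  have -> : #|A|%:R - 1 = #|(A :\ i)%SET|%:R :> R.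
    by rewrite (cardsD1 i A) iA natrD addrC addKr.
  by rewrite sumr_const -[RHS]mulr_natr mulrAC.
rewrite (eq_bigr (fun=> T)) => [|k]; last exact: sum_law_pair.
rewrite sumr_const mulr_natl.
by rewrite cardC1 card_ord.
Qed.

Lemma w_gt0 : 0 < w.
Proof. by rewrite powR_gt0 // invr_gt0 ltr0n. Qed.

Lemma powR_uniform_pred : n%:R^-1 `^ (alpha - 1) = w * n%:R.
Proof.
rewrite powRD; last by rewrite implybE invr_eq0 pnatr_eq0 -lt0n n_gt0 orbT.
by rewrite powR_inv1 ?invr_ge0 // invrK.
Qed.

Lemma wsum_uniform (A : {set 'I_n}) : wsum alpha u A = #|A|%:R * w.
Proof.
rewrite /wsum (eq_bigr (fun=> w)) ?sumr_const ?mulr_natl // => j _.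
by rewrite mxE.
Qed.

Lemma card_mem_neq0 (A : {set 'I_n}) (i : 'I_n) : i \in A -> #|A|%:R != 0 :> R.
Proof. by move=> iA; rewrite pnatr_eq0 cards_eq0; apply/set0Pn; exists i. Qed.

Lemma uniform_is_equilibrium : is_equilibrium p alpha u.
Proof.
split; first split.
- by move=> i; rewrite mxE invr_ge0.
- rewrite (eq_bigr (fun=> n%:R^-1)) => [|i _]; last by rewrite mxE.
  by rewrite sumr_const card_ord -[LHS]mulr_natr mulVf // pnatr_eq0 -lt0n.
apply/rowP => i; rewrite !mxE -/w -[X in - X + _](sum_law_inv_card i).
rewrite -[RHS](addNr (\sum_(A : {set 'I_n} | i \in A) p A / #|A|%:R)).
congr (_ + _); apply: eq_bigr => A iA; rewrite wsum_uniform.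
by field; rewrite (card_mem_neq0 iA) gt_eqF ?w_gt0.
Qed.

(** All colours have the same weight [w], so [wsum] is [#|A| * w] and every power of [w] cancels
    from the entries. *)
Lemma warm_jacobian_uniform :
  warm_jacobian p alpha u =
  (alpha * n%:R ^+ 2 * T - 1)%:M - const_mx (alpha * n%:R * T).
Proof.
have w0 : w != 0 by rewrite gt_eqF ?w_gt0.
apply/matrixP => i k; rewrite !mxE powR_uniform_pred -/w eq_sym.
have [ki|ki] := eqVneq i k.
  rewrite (eq_bigr (fun A : {set 'I_n} =>
    w^-1 * (p A * (#|A|%:R - 1) / #|A|%:R ^+ 2))); last first.
    move=> A iA; rewrite wsum_uniform.
    by field; rewrite (card_mem_neq0 iA).
  (* This matches the factor [n.-1] of the diagonal sum with [n ^+ 2 - n]. *)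
  have nE : n%:R = n.-1%:R + 1 :> R by rewrite natr1 prednK.
  by rewrite -mulr_sumr sum_law_diag nE mulr1n; field.
rewrite (eq_bigr (fun A : {set 'I_n} => w^-1 ^+ 2 * (p A / #|A|%:R ^+ 2))); last first.
  move=> A /andP[iA _]; rewrite wsum_uniform.
  by field; rewrite (card_mem_neq0 iA).
rewrite -mulr_sumr sum_law_pair 1?eq_sym // mulr0n.
by field.
Qed.

(** The sign of [q] is known only through [p], so [T] is read back as a pair sum over two distinct
    colours. *)
Lemma symmetric_sum_ge0 : (1 < n)%N -> 0 <= T.
Proof.
move=> n_gt1; rewrite -(@sum_law_pair (Ordinal n_gt0) (Ordinal n_gt1)) //.
by apply: sumr_ge0 => A _; rewrite divr_ge0 ?exprn_ge0 //; case: p_law.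
Qed.

End UniformEquilibrium.

(** * Spectrum of a scalar matrix minus a constant one *)

(** Summing the coordinates of the eigenvector equation forces either the second value or coordinate
    sum [s = 0]; in the latter case the constant matrix kills [v], and [z = a]. *)
Lemma eigenvalue_scalar_sub_const (F : fieldType) (n : nat) (a c z : F) :
  eigenvalue (a%:M - const_mx c : 'M[F]_n) z -> z = a \/ z = a - n%:R * c.
Proof.
case/eigenvalueP => v /rowP vM v_neq0.
pose s := \sum_j v 0 j.
have vME j : v 0 j * a - s * c = z * v 0 j.
  have := vM j; rewrite mulmxBr mul_mx_scalar !mxE => <-.
  rewrite mulr_suml mulrC; congr (_ - _); apply: eq_bigr => k _.
  by rewrite mxE.
have sE : s * (z - (a - n%:R * c)) = 0.
  have : \sum_j (v 0 j * a - s * c) = \sum_j z * v 0 j.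
    by apply: eq_bigr => j _; exact: vME.
  rewrite sumrB -mulr_suml -mulr_sumr sumr_const card_ord -/s -mulr_natl => e.
  by rewrite mulrBr [s * z]mulrC -e; ring.
have /rV0Pn[j vj] := v_neq0.
move/eqP: sE; rewrite mulf_eq0 => /orP[/eqP s0|]; last first.
  by rewrite subr_eq0 => /eqP ->; right.
left; have := vME j; rewrite s0 mul0r subr0 mulrC => /(mulIf vj) ->.
by [].
Qed.

Lemma scalar_sub_const_eigenvalue (F : fieldType) (n : nat) (a c : F) :
  (1 < n)%N -> eigenvalue (a%:M - const_mx c : 'M[F]_n) a.
Proof.
case: n => [|[|n]] // _.
(* The coordinates sum to zero, so [const_mx c] kills [v]; the two indices differ because the size
   is at least 2. *)
pose v : 'rV[F]_n.+2 := delta_mx 0 ord0 - delta_mx 0 ord_max.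
apply/eigenvalueP; exists v; last first.
  by apply/rV0Pn; exists ord0; rewrite !mxE !eqxx subr0 oner_neq0.
rewrite mulmxBr mul_mx_scalar; apply/eqP; rewrite subr_eq addrC -subr_eq subrr eq_sym.
apply/eqP; rewrite mulmxBl -!rowE; apply/rowP => j.
by rewrite !mxE subrr.
Qed.

Lemma Re_real_complex_lt0 (R : rcfType) (x : R) :
  ('Re (real_complex R x) < 0) = (x < 0).
Proof. by rewrite -complexRe; exact: (ltcR x 0). Qed.

Lemma Re_real_complex_gt0 (R : rcfType) (x : R) :
  (0 < 'Re (real_complex R x)) = (0 < x).
Proof. by rewrite -complexRe; exact: (ltcR 0 x). Qed.

(** For [-1] it is enough that no third eigenvalue exists: being negative, it never affects
    stability, and the sign of [lam] decides. *)
Lemma jacobian_eigenvalue_uniform (R : realType) (n : nat) (alpha : R)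
    (p : {set 'I_n} -> R) (q : nat -> R) :
  (1 < n)%N ->
  (forall (A : {set 'I_n}) (m : nat),
     (1 <= m <= n)%N -> #|A| = m -> p A = q m) ->
  let u : 'rV[R]_n := const_mx n%:R^-1 in
  let lam := alpha * n%:R ^+ 2 * symmetric_sum n q - 1 in
  jacobian_eigenvalue p alpha u (real_complex R lam) /\
  forall z, jacobian_eigenvalue p alpha u z ->
    z = real_complex R lam \/ z = real_complex R (-1).
Proof.
move=> n_gt1 pq u lam; rewrite /jacobian_eigenvalue.
rewrite (warm_jacobian_uniform alpha (ltnW n_gt1) pq).
rewrite raddfB /= map_scalar_mx map_const_mx.
split; first exact: scalar_sub_const_eigenvalue.
move=> z /eigenvalue_scalar_sub_const[->|->]; [by left|right].
rewrite -(rmorph_nat (real_complex R)) -rmorphM -rmorphB; congr (real_complex R _).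
by ring.
Qed.

(** For [n = 1] the full set is the only nonempty one, so [sum_law_inv_card] reads [q 1 = 1],
    against the strict bound. *)
Lemma subset_law_gt1 (R : realType) (n : nat) (p : {set 'I_n} -> R)
    (q : nat -> R) : (0 < n)%N -> is_subset_law p ->
  (forall (A : {set 'I_n}) (m : nat),
     (1 <= m <= n)%N -> #|A| = m -> p A = q m) ->
  q n < 1 -> (1 < n)%N.
Proof.
case: n p q => [|[|n]] // p q _ p_law pq.
have := sum_law_inv_card (ltn0Sn 0) p_law pq ord0.
rewrite (big_pred1 finset.setT) => [|A].
  by rewrite (pq _ 1%N) ?cardsT ?card_ord // invr1 mulr1 => ->; rewrite ltxx.
apply/idP/eqP => [A0|->]; last by rewrite inE.
by apply/setP => i; rewrite (ord1 i) A0 inE.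
Qed.

Theorem proposition1p18 (R : realType) (n : nat) (alpha : R)
  (p : {set 'I_n} -> R) (q : nat -> R)
  (hn : (1 <= n)%N) (halpha : 1 < alpha)
  (hp : is_subset_law p)
  (hpq : forall (A : {set 'I_n}) (m : nat),
     (1 <= m <= n)%N -> #|A| = m -> p A = q m)
  (hqn : q n < 1) :
  let u : 'rV[R]_n := const_mx n%:R^-1 in
  is_equilibrium p alpha u /\
  (linearly_stable p alpha u <-> (alpha%:E < critical_exponent n q)%E) /\
  (critical p alpha u <-> alpha%:E = critical_exponent n q).
Proof.
move=> u; split; first exact: uniform_is_equilibrium hpq.
have n_gt1 := subset_law_gt1 hn hp hpq hqn.
have [lam_eig eigE] := jacobian_eigenvalue_uniform alpha n_gt1 hpq.
have T_ge0 := symmetric_sum_ge0 hn hp hpq n_gt1.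
set lam := _ - 1 in lam_eig eigE.
have stableE : linearly_stable p alpha u <-> lam < 0.
  split => [st|lam0 z /eigE[|] ->]; rewrite ?Re_real_complex_lt0 ?ltrN10 //.
  by have := st _ lam_eig; rewrite Re_real_complex_lt0.
have unstableE : linearly_unstable p alpha u <-> 0 < lam.
  split => [[z /eigE[|] ->]|lam0]; rewrite ?Re_real_complex_gt0 ?ltr0N1 //.
  by exists (real_complex R lam); rewrite ?Re_real_complex_gt0.
have criticalE : critical p alpha u <-> lam = 0.
  rewrite /critical stableE unstableE; split => [[]|->]; last by rewrite ltxx.
  by case: ltgtP.
rewrite stableE criticalE /critical_exponent /lam.
(* If the sum is 0, then [lam = -1] and the exponent is [+oo]: stable and not critical. *)
have [->|T_neq0] := eqVneq (symmetric_sum n q) 0.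
  rewrite mulr0 sub0r ltry ltrN10; split=> //; split=> // /eqP.
  by rewrite oppr_eq0 oner_eq0.
(* Otherwise the denominator is positive, and multiplying through by it turns the comparison of
   [alpha] with the exponent into that of [lam] with 0. *)
have d_gt0 : 0 < n%:R ^+ 2 * symmetric_sum n q.
  by rewrite mulr_gt0 ?exprn_gt0 ?ltr0n // lt0r T_neq0.
rewrite lte_fin ltr_pdivlMr // subr_lt0 -mulrA; split => //.
split => [/eqP|[->]]; last by rewrite mul1r mulVf ?subrr // gt_eqF.
by rewrite subr_eq0 => /eqP h; rewrite -[X in X / _]h mulfK // gt_eqF.
Qed.
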